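(* For any $n\ge1$ the dual automaton of the Bellaterra type automaton $B^{(n)}$ defines a group that acts transitively on each level of the rooted subtree of $Q_n^*$ formed by no-double-letter words, where $Q_n$ is the set of internal states of $B^{(n)}$.
   Context: An automaton is a quadruple $(Q,X,\phi,\psi)$ with nonempty sets $Q$ (internal states) and $X$ (finite alphabet), a state transition function $\phi:Q\times X\to Q$ and an output function $\psi:Q\times X\to X$. $X^*$ is the set of finite words over $X$ (including the empty word), viewed as a rooted tree. For an automaton $Y=(Q,X,\phi,\psi)$ and $q\in Q$, the transformation $Y_q:X^*\to X^*$ is defined recursively by $Y_q(\varnothing)=\varnothing$ and $Y_q(xw)=\psi(q,x)\,Y_{\phi(q,x)}(w)$ for $x\in X$, $w\in X^*$. $Y$ is invertible if all $Y_q$ are bijective; then the group defined by $Y$ is the group of transformations of $X^*$ generated (under composition) by $Y_q$, $q\in Q$. The dual automaton of a finite automaton $(Q,X,\phi,\psi)$ is the automaton $(X,Q,\tilde\phi,\tilde\psi)$ with state set $X$ and alphabet $Q$, where $\tilde\phi(x,q)=\psi(q,x)$ and $\tilde\psi(x,q)=\phi(q,x)$. A word is a no-double-letter word if no two adjacent letters of it coincide. The $k$-th level of the subtree of no-double-letter words is the set of no-double-letter words of length $k$; acting on this subtree means in particular that the set of no-double-letter words is invariant. Bellaterra type automata: for $n\ge1$, $B^{(n)}=(Q_n,\{0,1\},\phi_n,\widehat\psi_n)$, where $Q_1=\{a_1,b_1,c_1\}$ and $Q_n=\{a_n,b_n,c_n,q_{n1},\dots,q_{n,2n-2}\}$ for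 $n\ge2$ (a set of $2n+1$ elements). With $q_{n0}:=c_n$ and $q_{n,2n-1}:=a_n$: $\phi_n(a_n,0)=\phi_n(b_n,1)=c_n$, $\phi_n(a_n,1)=\phi_n(b_n,0)=b_n$, and $\phi_n(q_{ni},0)=\phi_n(q_{ni},1)=q_{n,i+1}$ for $0\le i\le 2n-2$. For $x\in\{0,1\}$: $\widehat\psi_n(q,x)=x$ if $q\in\{a_n,b_n\}$, and $\widehat\psi_n(q,x)=1-x$ if $q\in Q_n\setminus\{a_n,b_n\}$. The dual automaton of $B^{(n)}$ is invertible. *)

(* Defs.v *)
From HB Require Import structures.
From mathcomp Require Import all_boot.

Set Implicit Arguments.
Unset Strict Implicit.
Unset Printing Implicit Defensive.

Record automaton (Q : Type) (X : finType) := Automaton {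
  transition : Q -> X -> Q;
  output : Q -> X -> X;
  states_nonempty : inhabited Q;
  letters_nonempty : inhabited X
}.

Section Automata.
Variables (Q : Type) (X : finType).
Implicit Type Y : automaton Q X.

(** [run Y q] is Y_q. *)
Fixpoint run Y (q : Q) (w : seq X) : seq X :=
  if w is x :: w' then output Y q x :: run Y (transition Y q x) w' else [::].

Definition invertible Y := forall q, bijective (run Y q).

(** Membership in the group of transformations generated by the Y_q. This is
    a group of bijections only when [Y] is invertible. *)
Inductive automaton_group Y : (seq X -> seq X) -> Prop :=
| AutomatonGroupGen q : automaton_group Y (run Y q)
| AutomatonGroupId : automaton_group Y id
| AutomatonGroupComp f g :
    automaton_group Y f -> automaton_group Y g -> automaton_group Y (f \o g)
| AutomatonGroupInv f g :
    automaton_group Y f -> cancel f g -> cancel g f -> automaton_group Y g.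

End Automata.

Definition dual (Q X : finType) (Y : automaton Q X) : automaton X Q :=
  Automaton (fun x q => output Y q x) (fun x q => transition Y q x)
            (letters_nonempty Y) (states_nonempty Y).

Definition no_double_letter (X : eqType) (w : seq X) : bool :=
  sorted (fun x y => x != y) w.

Definition no_double_letter_level (X : eqType) (k : nat) : pred (seq X) :=
  [pred w | (size w == k) && no_double_letter w].
Arguments no_double_letter_level : clear implicits.

Definition acts_transitively_on (T : Type) (G : (T -> T) -> Prop) (S : pred T) :=
  (forall g, G g -> forall x, S x -> S (g x)) /\
  (forall x y, S x -> S y -> exists2 g, G g & g x = y).

(** [BQ j] is q_{n,j+1}, for 0 <= j < 2n-2. *)
Inductive bellaterra_state (n : nat) : Type :=
| BA | BB | BC | BQ of 'I_(2 * n - 2).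

Arguments BA {n}.
Arguments BB {n}.
Arguments BC {n}.

Section Bellaterra.
Variable n : nat.

Definition bellaterra_state_code (q : bellaterra_state n) :
    option (option (option 'I_(2 * n - 2))) :=
  match q with
  | BA => None
  | BB => Some None
  | BC => Some (Some None)
  | BQ j => Some (Some (Some j))
  end.

Definition bellaterra_state_decode
    (c : option (option (option 'I_(2 * n - 2)))) : bellaterra_state n :=
  match c with
  | None => BA
  | Some None => BB
  | Some (Some None) => BC
  | Some (Some (Some j)) => BQ j
  end.

Lemma bellaterra_state_codeK :
  cancel bellaterra_state_code bellaterra_state_decode.
Proof. by case. Qed.

Lemma bellaterra_state_decodeK :
  cancel bellaterra_state_decode bellaterra_state_code.
Proof. by case=> [[[]|]|]. Qed.

HB.instance Definition _ :=
  Finite.copy (bellaterra_state n) (can_type bellaterra_state_codeK).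

Lemma card_bellaterra_state : 0 < n -> #|{: bellaterra_state n}| = 2 * n + 1.
Proof.
move=> n_gt0.
have codeP : bijective bellaterra_state_code.
  by exists bellaterra_state_decode;
    [exact: bellaterra_state_codeK | exact: bellaterra_state_decodeK].
rewrite (bij_eq_card codeP) !card_option card_ord.
by case: n n_gt0 => // m _; rewrite mulnS addKn addn1 !addSn.
Qed.

(** q_{ni} for 0 <= i <= 2n-1, with q_{n0} = c_n and q_{n,2n-1} = a_n. *)
Definition bellaterra_q (i : nat) : bellaterra_state n :=
  if i is j.+1 then oapp (@BQ n) BA (insub j) else BC.

(** The letters 0 and 1 are [false] and [true]. *)
Definition bellaterra_transition (q : bellaterra_state n) (x : bool) :
    bellaterra_state n :=
  match q with
  | BA => if x then BB else BC
  | BB => if x then BC else BB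
  | BC => bellaterra_q 1
  | BQ j => bellaterra_q j.+2
  end.

Definition bellaterra_output (q : bellaterra_state n) (x : bool) : bool :=
  match q with
  | BA | BB => x
  | BC | BQ _ => ~~ x
  end.

Definition bellaterra : automaton (bellaterra_state n) bool :=
  Automaton bellaterra_transition bellaterra_output
            (inhabits BA) (inhabits false).

Lemma bellaterra_q_last : 0 < n -> bellaterra_q (2 * n - 1) = BA.
Proof.
move=> n_gt0; have -> : 2 * n - 1 = (2 * n - 2).+1.
  by case: n n_gt0 => // m _; rewrite mulnS addKn add2n subn1.
by rewrite /bellaterra_q insubF // ltnn.
Qed.

Lemma bellaterra_transition_q i x : i < 2 * n - 1 ->
  bellaterra_transition (bellaterra_q i) x = bellaterra_q i.+1.
Proof.
case: i => [//|j]; rewrite ltn_subRL add1n => j_lt.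
have jP : j < 2 * n - 2 by rewrite ltn_subRL add2n.
by rewrite /= insubT.
Qed.

Lemma bellaterra_output_q i x : i < 2 * n - 1 ->
  bellaterra_output (bellaterra_q i) x = ~~ x.
Proof.
case: i => [//|j]; rewrite ltn_subRL add1n => j_lt.
have jP : j < 2 * n - 2 by rewrite ltn_subRL add2n.
by rewrite /= insubT.
Qed.

End Bellaterra.

(* Main.v *)
Require Import Defs.
From mathcomp Require Import all_boot.

(** Write D_0, D_1 for the generators of the dual group G. Applying a
    transposition to every letter of a word turns D_0 into D_1: (a b) when
    applied before, (b c) when applied after. So G contains the letterwise
    action of Sym{a,b,c}. Moreover D_0 followed by the letterwise (a c) is the
    product of two commuting maps, the letterwise cycle of odd length 2n-1 on
    the letters other than a, b, and the involution t which swaps a and b at the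
    positions preceded by an odd number of letters other than a, b. Its power
    2n-1 is t, so t is in G.

    Let u be the alternating word abab... Since t fixes uc and exchanges uca and
    ucb, induction on the length shows that the subgroup generated by
    Sym{a,b,c} and t is transitive on the no-double-letter words of given length
    over {a,b,c}. For arbitrary words, induction reduces to words uz with z a
    letter, and powers of the product above, which fix u, move c to any letter
    z other than a, b. *)

Set Implicit Arguments.
Unset Strict Implicit.
Unset Printing Implicit Defensive.

(** * Invertibility from injective output functions *)

Section RunBijective.
Variables (Q : Type) (X : finType) (Y : automaton Q X).
Hypothesis output_inj : forall q, injective (output Y q).

Fixpoint run_inv q (w : seq X) : seq X :=
  if w is y :: w' then
    let x := invF (@output_inj q) y in x :: run_inv (transition Y q x) w'
  else [::].

Lemma invertible_output_inj : invertible Y.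
Proof.
move=> q; exists (run_inv q) => w.
  by elim: w q => //= x w IHw q; rewrite invF_f IHw.
by elim: w q => //= x w IHw q; rewrite f_invF IHw.
Qed.

End RunBijective.

(** * Automaton groups and their orbits on words *)

Section AutomatonGroup.
Variables (Q : Type) (X : finType) (Y : automaton Q X).
Implicit Type g : seq X -> seq X.

(** Supplies the inverse map that [AutomatonGroupInv] takes as given, built along the generation of
    [g]. *)
Lemma automaton_group_inverse g : invertible Y -> automaton_group Y g ->
  exists2 g', automaton_group Y g' & cancel g g' /\ cancel g' g.
Proof.
move=> invY; elim=> {g} [q||f g _ [f' Gf' [fK f'K]] _ [g' Gg' [gK g'K]]|].
- have [g' gK g'K] := invY q; exists g' => //.
  exact: AutomatonGroupInv (AutomatonGroupGen Y q) gK g'K.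
- by exists id; first exact: AutomatonGroupId.
- exists (g' \o f'); first exact: AutomatonGroupComp.
  by split; apply: can_comp.
- by move=> f g Gf _ fK gK; exists f.
Qed.

Lemma size_automaton_group g w : automaton_group Y g -> size (g w) = size w.
Proof.
move=> Gg; elim: Gg w => {g} [q||f g _ IHf _ IHg|f g _ IHf _ gK] w //=.
- by elim: w q => //= x w IHw q; rewrite IHw.
- by rewrite IHf IHg.
- by rewrite -(IHf (g w)) gK.
Qed.

(** Group elements are automorphisms of the rooted tree of words, so they respect prefixes; this is
    what allows inductions that append a last letter. *)
Lemma automaton_group_take g i w :
  automaton_group Y g -> g (take i w) = take i (g w).
Proof.
move=> Gg; elim: Gg i w => {g} [q||f g _ IHf _ IHg|f g _ IHf fK gK] i w //=.
- by elim: w q i => [|x w IHw] q [|i] //=; rewrite IHw.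
- by rewrite IHg IHf.
- by apply: (can_inj fK); rewrite IHf !gK.
Qed.

Lemma automaton_group_rcons g w x : automaton_group Y g ->
  exists y, g (rcons w x) = rcons (g w) y.
Proof.
move=> Gg; have := size_automaton_group (rcons w x) Gg.
have := automaton_group_take (size w) (rcons w x) Gg.
rewrite -{1}cats1 take_size_cat // => ->; rewrite size_rcons.
case/lastP: (g _) => // v y; rewrite size_rcons => -[<-].
by exists y; rewrite -{2}cats1 take_size_cat.
Qed.

(** Membership up to pointwise equality: maps such as [map swap_ab] are compared with group elements
    word by word. *)
Definition represented g := exists2 f, automaton_group Y f & f =1 g.

Lemma represented_comp f g :
  represented f -> represented g -> represented (f \o g).
Proof.
move=> [f' Gf' f'E] [g' Gg' g'E]; exists (f' \o g').
  exact: AutomatonGroupComp.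
by move=> w; rewrite /= f'E g'E.
Qed.

Lemma represented_iter i f : represented f -> represented (iter i f).
Proof.
move=> Gf; elim: i => [|i IHi]; first by exists id => //; apply: AutomatonGroupId.
exact: represented_comp Gf IHi.
Qed.

(** Since [g] preserves and reflects [P] on every word, the relation is symmetric, and [P] still
    controls a word extended beyond [w]. *)
Definition orbit_in (P : pred (seq X)) (w w' : seq X) :=
  exists g, [/\ automaton_group Y g, forall v, P (g v) = P v & g w = w'].

Lemma orbit_in_refl P w : orbit_in P w w.
Proof. by exists id; split=> //; apply: AutomatonGroupId. Qed.

Lemma orbit_in_sym P w w' : invertible Y -> orbit_in P w w' -> orbit_in P w' w.
Proof.
move=> invY [g [Gg gP <-]].
have [g' Gg' [gK g'K]] := automaton_group_inverse invY Gg.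
by exists g'; split=> // v; rewrite -gP g'K.
Qed.

Lemma orbit_in_trans P w2 w1 w3 :
  orbit_in P w1 w2 -> orbit_in P w2 w3 -> orbit_in P w1 w3.
Proof.
move=> [f [Gf fP <-]] [g [Gg gP <-]]; exists (g \o f); split=> //.
  exact: AutomatonGroupComp.
by move=> v /=; rewrite gP fP.
Qed.

Lemma orbit_in_sub P w w' : orbit_in P w w' -> orbit_in xpredT w w'.
Proof. by case=> g [Gg _ gw]; exists g. Qed.

Lemma orbit_in_represented P g w : represented g ->
  (forall v, P (g v) = P v) -> orbit_in P w (g w).
Proof. by move=> [f Gf fE] gP; exists f; split=> // v; rewrite fE. Qed.

End AutomatonGroup.

(** * No-double-letter words extended on the right *)

Lemma no_double_letter_rcons (X : eqType) (w : seq X) x y :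
  no_double_letter (rcons (rcons w x) y)
    = no_double_letter (rcons w x) && (x != y).
Proof.
rewrite /no_double_letter; case: w => [|z w] /=; first by rewrite andbT.
by rewrite rcons_path last_rcons.
Qed.

Lemma no_double_letter_rconsW (X : eqType) (w : seq X) x :
  no_double_letter (rcons w x) -> no_double_letter w.
Proof.
by case/lastP: w => // w y; rewrite no_double_letter_rcons => /andP[].
Qed.

(** * Letterwise permutations, the parity flip, and the dual automaton *)

Section DualBellaterra.
Variable n : nat.
Local Notation state := (bellaterra_state n).
Local Notation D := (dual (bellaterra n)).
Implicit Types (q : state) (w : seq state) (x : bool).

Definition swap_ab q := match q with BA => BB | BB => BA | _ => q end.
Definition swap_bc q := match q with BB => BC | BC => BB | _ => q end.
Definition swap_ac q := match q with BA => BC | BC => BA | _ => q end.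

(** The cycle (c q_1 ... q_{2n-2}). *)
Definition rot_q q :=
  match q with BA | BB => q | _ => swap_ac (bellaterra_transition q false) end.

(** [flip_ab true] swaps [a] and [b] at the positions preceded by an even
    number of letters other than [a], [b]; [flip_ab false], at the other ones. *)
Fixpoint flip_ab x w : seq state :=
  if w is q :: w' then
    (if x then swap_ab q else q) :: flip_ab (bellaterra_output q x) w'
  else [::].

Lemma iter_rot_q i : i <= 2 * n - 2 -> iter i rot_q BC = bellaterra_q n i.
Proof.
elim: i => // i IHi lti; rewrite iterS IHi 1?ltnW //.
case: i {IHi} lti => [|i] lti /=; first by rewrite insubT.
by rewrite (insubT (fun j => j < _) (ltnW lti)) /= insubT.
Qed.

Lemma BQ_iter_rot_q (j : 'I_(2 * n - 2)) : BQ j = iter j.+1 rot_q BC.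
Proof. by rewrite iter_rot_q //= valK. Qed.

(** Each [BQ j] lies on the cycle through c, so it suffices that c returns; for n >= 1 the exponent
    is the cycle length 2n-1. *)
Lemma iter_rot_q_id : iter (2 * n - 2).+1 rot_q =1 id.
Proof.
have fixC : iter (2 * n - 2).+1 rot_q BC = BC.
  rewrite iterS iter_rot_q //; case E: (2 * n - 2) => [|i] /=.
    by rewrite insubF // E.
  by rewrite insubT ?E //= => lti; rewrite insubF // E ltnn.
have fixed q : rot_q q = q -> forall i, iter i rot_q q = q.
  by move=> qE; elim=> //= i ->.
case=> [|||j]; [exact: fixed | exact: fixed | exact: fixC |].
by rewrite BQ_iter_rot_q -iterD addnC iterD fixC.
Qed.

Lemma rot_q_inj : injective rot_q.
Proof.
suff: cancel rot_q (iter (2 * n - 2) rot_q) by apply: can_inj.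
by move=> q; rewrite -iterSr iter_rot_q_id.
Qed.

Lemma swap_abK : involutive swap_ab.
Proof. by case. Qed.

(** One-letter form of the factorization into cycle and flip: passing from input 0 to input 1 only
    exchanges the roles of a and b. *)
Lemma swap_ac_transition q x : swap_ac (bellaterra_transition q x)
  = rot_q (if x then swap_ab q else q).
Proof. by case: q x => [|||j] []. Qed.

Lemma transition_inj x : injective (bellaterra_transition (n := n) ^~ x).
Proof.
move=> q q' /= /(congr1 swap_ac); rewrite !swap_ac_transition => /rot_q_inj.
by case: x => //; apply: (inv_inj swap_abK).
Qed.

Lemma dual_bellaterra_invertible : invertible D.
Proof. by apply: invertible_output_inj => x; apply: transition_inj. Qed.

Lemma no_double_letter_run x w :
  no_double_letter (run D x w) = no_double_letter w.
Proof.
case: w => //= q w; rewrite /no_double_letter /=.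
elim: w q x => //= q' w IHw q x; rewrite IHw; congr (~~ _ && _).
(* Either the output is [x] itself, or the transition ignores its input. Hence both adjacent letters
   pass through the same injection. *)
have ->: bellaterra_transition q x
    = bellaterra_transition q (bellaterra_output q x) by case: q x => [|||j] [].
exact: (inj_eq (@transition_inj _)).
Qed.

Lemma no_double_letter_group g w :
  automaton_group D g -> no_double_letter (g w) = no_double_letter w.
Proof.
move=> Gg; elim: Gg w => {g} [x||f g _ IHf _ IHg|f g _ IHf _ gK] w //=.
- exact: no_double_letter_run.
- by rewrite IHf IHg.
- by rewrite -(IHf (g w)) gK.
Qed.

(** Exchanging a and b has the same effect on transitions as exchanging 0 and 1, and the two runs
    stay in complementary states. *)
Lemma run_map_swap_ab x w : run D x (map swap_ab w) = run D (~~ x) w.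
Proof. by elim: w x => //= -[|||j] w IHw [] /=; rewrite IHw. Qed.

(** From a or b the two inputs lead to b and c in some order; from any other letter the target is
    neither b nor c. *)
Lemma map_swap_bc_run x w : map swap_bc (run D x w) = run D (~~ x) w.
Proof.
by elim: w x => //= -[|||j] w IHw []; rewrite /= IHw //; case: insubP.
Qed.

(** * Elements of the dual group *)

Lemma represented_run x : represented D (run D x).
Proof. by exists (run D x) => //; apply: AutomatonGroupGen. Qed.

(** The element is D_0^-1 D_1, the right factor acting first. *)
Lemma represented_swap_ab : represented D (map swap_ab).
Proof.
have [g Gg [gK _]] :=
  automaton_group_inverse dual_bellaterra_invertible (AutomatonGroupGen D false).
exists (g \o run D true) => [|w]; last by rewrite /= -(run_map_swap_ab false) gK.
by apply: AutomatonGroupComp Gg _; apply: AutomatonGroupGen.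
Qed.

(** The element is D_1 D_0^-1. *)
Lemma represented_swap_bc : represented D (map swap_bc).
Proof.
have [g Gg [_ gK]] :=
  automaton_group_inverse dual_bellaterra_invertible (AutomatonGroupGen D false).
exists (run D true \o g) => [|w]; last by rewrite /= -(map_swap_bc_run false) gK.
by apply: AutomatonGroupComp Gg; apply: AutomatonGroupGen.
Qed.

Definition rot_flip w := map rot_q (flip_ab false w).

Lemma map_swap_ac_run x w : map swap_ac (run D x w) = map rot_q (flip_ab x w).
Proof. by elim: w x => //= q w IHw x; rewrite IHw swap_ac_transition. Qed.

Lemma represented_rot_flip : represented D rot_flip.
Proof.
(* Letterwise, (a c) = (a b)(b c)(a b). *)
have [g Gg gE] := represented_comp
  (represented_comp (represented_comp represented_swap_ab represented_swap_bc)
     represented_swap_ab) (represented_run false).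
exists g => // w; rewrite gE /rot_flip -map_swap_ac_run /= -!map_comp.
by apply: eq_map; case.
Qed.

Lemma flip_abK x : involutive (flip_ab x).
Proof. by move=> w; elim: w x => //= -[|||j] w IHw [] /=; rewrite IHw. Qed.

Lemma output_rot_q q x :
  bellaterra_output (rot_q q) x = bellaterra_output q x.
Proof. by case: q => //= [|j]; case: insubP. Qed.

Lemma swap_ab_rot_q q : swap_ab (rot_q q) = rot_q (swap_ab q).
Proof. by case: q => //= [|j]; case: insubP. Qed.

(** The cycle permutes the letters other than a, b among themselves, so it keeps the parities that
    govern the flip, and it fixes a and b. *)
Lemma flip_ab_rot_q x w : flip_ab x (map rot_q w) = map rot_q (flip_ab x w).
Proof.
elim: w x => //= q w IHw x; rewrite output_rot_q IHw.
by case: x => //; rewrite swap_ab_rot_q.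
Qed.

Lemma iter_rot_flip i w :
  iter i rot_flip w = map (iter i rot_q) (iter i (flip_ab false) w).
Proof.
have -> : iter i rot_flip w = iter i (map rot_q) (iter i (flip_ab false) w).
  elim: i => //= i ->; rewrite /rot_flip; congr (map _ _).
  by elim: i (iter i (flip_ab false) w) => //= i IHi v; rewrite flip_ab_rot_q IHi.
elim: i (iter i _ w) => [|i IHi] v /=; first by rewrite map_id.
by rewrite IHi -map_comp.
Qed.

Lemma represented_flip_ab : represented D (flip_ab false).
Proof.
have [g Gg gE] := represented_iter (2 * n - 2).+1 represented_rot_flip.
exists g => // w; rewrite gE iter_rot_flip (eq_map iter_rot_q_id) map_id.
have iter_flip : forall i, iter i.*2 (flip_ab false) w = w.
  by elim=> // i IHi; rewrite doubleS !iterS IHi flip_abK.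
(* As [2 * n - 2] is twice [n - 1], those flips cancel and the one split off by [iterS] remains. *)
by rewrite iterS -{2}(muln1 2) -mulnBr mul2n iter_flip.
Qed.

(** * Alternating words in a and b *)

Definition is_ab q := match q with BA | BB => true | _ => false end.
Definition is_abc q := if q is BQ _ then false else true.

Fixpoint alternating k : seq state :=
  if k is k'.+1 then rcons (alternating k') (if odd k' then BB else BA)
  else [::].

Lemma size_alternating k : size (alternating k) = k.
Proof. by elim: k => //= k IHk; rewrite size_rcons IHk. Qed.

Lemma alternating_ab k : all is_ab (alternating k).
Proof. by elim: k => //= k IHk; rewrite all_rcons IHk; case: odd. Qed.

Lemma alternating_abc k : all is_abc (alternating k).
Proof. by apply: sub_all (alternating_ab k); case. Qed.

Lemma no_double_letter_alternating k : no_double_letter (alternating k).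
Proof.
elim: k => // -[//|k] IHk.
by rewrite /= no_double_letter_rcons IHk; case: odd.
Qed.

Lemma no_double_letter_alternating_c k :
  no_double_letter (rcons (alternating k) BC).
Proof.
case: k => // k; rewrite [alternating _]/= no_double_letter_rcons.
by rewrite (no_double_letter_alternating k.+1); case: odd.
Qed.

Lemma flip_ab_cat u w :
  all is_ab u -> flip_ab false (u ++ w) = u ++ flip_ab false w.
Proof. by elim: u => //= -[] //= u IHu /IHu->. Qed.

(** No letter of [u] changes the parity, so nothing is flipped, and the cycle moves at most the last
    letter. *)
Lemma rot_flip_rcons u q :
  all is_ab u -> rot_flip (rcons u q) = rcons u (rot_q q).
Proof.
move=> abu; rewrite /rot_flip -!cats1 flip_ab_cat // map_cat; congr (_ ++ _).
by elim: u abu => //= -[] //= u IHu /IHu->.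
Qed.

(** * Transitivity on words over {a,b,c} *)

Local Notation abc_orbit := (orbit_in D (all is_abc)).

Lemma abc_orbit_swap_ab w : abc_orbit w (map swap_ab w).
Proof.
apply: orbit_in_represented represented_swap_ab _ => v.
by rewrite all_map; apply: eq_all; case.
Qed.

Lemma abc_orbit_swap_bc w : abc_orbit w (map swap_bc w).
Proof.
apply: orbit_in_represented represented_swap_bc _ => v.
by rewrite all_map; apply: eq_all; case.
Qed.

Lemma abc_orbit_flip_ab w : abc_orbit w (flip_ab false w).
Proof.
apply: orbit_in_represented represented_flip_ab _ => v.
by elim: v false => //= -[|||j] v IHv [] /=; rewrite ?IHv.
Qed.

Lemma abc_orbit_letter q : is_abc q -> abc_orbit [:: q] [:: BC].
Proof.
have BC_orbit : abc_orbit [:: BB] [:: BC] by apply: abc_orbit_swap_bc.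
case: q => // _; last exact: orbit_in_refl.
by apply: orbit_in_trans BC_orbit; apply: abc_orbit_swap_ab.
Qed.

Lemma abc_transitive w w' : all is_abc w -> all is_abc w' ->
  no_double_letter w -> no_double_letter w' -> size w = size w' ->
  abc_orbit w w'.
Proof.
have invD := dual_bellaterra_invertible.
move: {2}(size w) (erefl (size w)) => k.
elim: k w w' => [|k IHk] w w' sw abcw abcw' ndw ndw' /esym; rewrite sw => sw'.
  by rewrite (size0nil sw) (size0nil sw'); apply: orbit_in_refl.
(* By symmetry and transitivity, one common representative for each length is enough. *)
suff to_rep : exists v, forall u, all is_abc u -> no_double_letter u ->
    size u = k.+1 -> abc_orbit u v.
  have [v vP] := to_rep; apply: (orbit_in_trans (vP w _ _ _)) => //.
  by apply: orbit_in_sym => //; apply: vP.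
case: k {w w' sw sw' abcw abcw' ndw ndw'} IHk => [_|k IHk].
  exists [:: BC] => -[|q []] //=; rewrite andbT => abcq _ _.
  exact: abc_orbit_letter.
(* The induction hypothesis brings the prefix to [alternating k] followed by c. The last letter then
   differs from c, and the flip exchanges the two choices a and b. *)
exists (rcons (rcons (alternating k) BC) BA) => u.
case/lastP: u => // u q.
rewrite all_rcons size_rcons => /andP[abcq abcu] nduq [su].
have [||||g [Gg gP gu]] := IHk u (rcons (alternating k) BC) su abcu.
- by rewrite all_rcons alternating_abc.
- exact: no_double_letter_rconsW nduq.
- exact: no_double_letter_alternating_c.
- by rewrite size_rcons size_alternating.
have [y gy] := automaton_group_rcons u q Gg; rewrite gu in gy.
have: no_double_letter (g (rcons u q)) by rewrite no_double_letter_group.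
have: all is_abc (g (rcons u q)) by rewrite gP all_rcons abcq.
have: abc_orbit (rcons u q) (g (rcons u q)) by exists g.
rewrite gy all_rcons no_double_letter_rcons.
case: y {gy} => [|||j] // uy _ /andP[_ //] _.
apply: orbit_in_trans uy _; rewrite -!cats1 -!catA.
have <- : flip_ab false (alternating k ++ [:: BC; BB])
    = alternating k ++ [:: BC; BA] by rewrite flip_ab_cat // alternating_ab.
exact: abc_orbit_flip_ab.
Qed.

(** * Transitivity on all no-double-letter words *)

Lemma orbit_alternating w : no_double_letter w ->
  orbit_in D xpredT w (alternating (size w)).
Proof.
elim/last_ind: w => [|w q IHw] ndwq; first exact: orbit_in_refl.
have [g [Gg _ gw]] := IHw (no_double_letter_rconsW ndwq).
have [y gy] := automaton_group_rcons w q Gg; rewrite gw in gy.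
have: no_double_letter (g (rcons w q)) by rewrite no_double_letter_group.
have: orbit_in D xpredT (rcons w q) (g (rcons w q)) by exists g.
rewrite gy size_rcons => wy ndy; apply: orbit_in_trans wy _.
have abc_orbit_alternating z : is_abc z ->
    no_double_letter (rcons (alternating (size w)) z) ->
    orbit_in D xpredT (rcons (alternating (size w)) z)
      (alternating (size w).+1).
  move=> abcz ndz; apply: orbit_in_sub (abc_transitive _ _ ndz _ _).
  - by rewrite all_rcons abcz alternating_abc.
  - exact: alternating_abc.
  - exact: no_double_letter_alternating.
  - by rewrite size_rcons !size_alternating.
case abcy: (is_abc y); first exact: abc_orbit_alternating.
case: y abcy {gy ndy} => // j _.
apply: orbit_in_trans (abc_orbit_alternating BC isT
  (no_double_letter_alternating_c _)).
apply: orbit_in_sym dual_bellaterra_invertible _.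
(* Since c is q_0 and [BQ j] is q_{j+1}, it takes [j.+1] turns of the cycle to reach [BQ j] from
   c. *)
have <- : iter j.+1 rot_flip (rcons (alternating (size w)) BC)
    = rcons (alternating (size w)) (BQ j).
  rewrite BQ_iter_rot_q; elim: j.+1 => // i IHi.
  by rewrite !iterS IHi rot_flip_rcons // alternating_ab.
by apply: orbit_in_represented => //; apply/represented_iter/represented_rot_flip.
Qed.

End DualBellaterra.

Theorem proposition1p10 (n : nat) (hn : 1 <= n) :
  invertible (dual (bellaterra n)) /\
  forall k : nat,
    acts_transitively_on (automaton_group (dual (bellaterra n)))
                         (no_double_letter_level (bellaterra_state n) k).
Proof.
split=> [|k]; first exact: dual_bellaterra_invertible.
split=> [g Gg w|w w' /andP[/eqP sw ndw] /andP[/eqP sw' ndw']].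
  rewrite /no_double_letter_level /= (size_automaton_group w Gg).
  by rewrite (no_double_letter_group w Gg).
(* Both words are joined through the alternating word of their common length. *)
have := orbit_in_sym (@dual_bellaterra_invertible n) (orbit_alternating ndw').
rewrite sw' -sw => /(orbit_in_trans (orbit_alternating ndw)) [g [Gg _ gw]].
by exists g.
Qed.
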